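(* For each $n$ let $\mathbf{p}=\mathbf{p}^{(n)}=\{p_{ij}\}_{i,j\in[n]}$ be a collection of edge probabilities and let $s=s_n\in[0,1]$, and let $(G_1,G_2)$ be a pair of correlated inhomogeneous random graphs on $[n]$ with parameters $(\mathbf{p},s)$ and latent permutation $\pi_*$. Let $p_{\max}:=\max_{i,j\in[n]}p_{ij}$. Suppose that $p_{\max}\le n^{-\alpha+o(1)}$ for some constant $\alpha\in(1/2,1]$ and that $k$ is a positive integer (possibly depending on $n$) with $k>12/(2\alpha-1)$. Let $(\widehat M_k,\widehat\mu_k)$ be the $k$-core estimator of $(G_1,G_2)$. Then, with probability $1-o(1)$ as $n\to\infty$, $$\widehat M_k=\mathrm{core}_k(G_1\wedge_{\pi_*}G_2)\quad\text{and}\quad \widehat\mu_k\{\widehat M_k\}=\pi_*\{\widehat M_k\},$$ where $\mathrm{core}_k(\cdot)$ is identified with its vertex set.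
   Context: Edge probabilities: $\mathbf{p}=\{p_{ij}\}_{i,j\in[n]}$ with $p_{ij}\in[0,1]$, $p_{ij}=p_{ji}$, $p_{ii}=0$. The inhomogeneous random graph with parameter $\mathbf{p}$ is the simple undirected random graph on $[n]$ in which each edge $\{i,j\}$ is present with probability $p_{ij}$, independently over unordered pairs. Correlated inhomogeneous random graphs with parameters $(\mathbf{p},s)$: generate an inhomogeneous random graph $G$ with parameter $\mathbf{p}$; conditionally on $G$, generate $G_1$ and $G_2'$ independently, each keeping every edge of $G$ independently with probability $s$ (same vertex set $[n]$); finally let $\pi_*$ be an independent uniformly random permutation of $[n]$ and let $G_2$ be $G_2'$ with vertices relabelled by $\pi_*$, so that $\{\pi_*(i),\pi_*(j)\}$ is an edge of $G_2$ iff $\{i,j\}$ is an edge of $G_2'$. A matching is a pair $(M,\mu)$ with $M\subseteq[n]$ and $\mu:M\to[n]$ injective. $G_1\wedge_\mu G_2$ is the graph on vertex set $M$ in which $\{i,j\}$ is an edge iff $\{i,j\}$ is an edge of $G_1$ and $\{\mu(i),\mu(j)\}$ is an edge of $G_2$. A matching is a $k$-core matching if every vertex of $G_1\wedge_\mu G_2$ has degree at least $k$ (the empty matching qualifies vacuously). The $k$-core estimator $(\widehat M_k,\widehat\mu_k)$ is a $k$-core matching of $(G_1,G_2)$ with $|M|$ as large as possible among all $k$-core matchings (ties broken arbitrarily). $\mathrm{core}_k(G)$ is the $k$-core of $G$, the maximal subgraph with minimum degree at least $k$ (possibly empty). For a map $\mu$ and a subset $S$ of its domain, $\mu\{S\}:=\{(i,\mu(i)):i\in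 S\}$. The notation $p_{\max}\le n^{-\alpha+o(1)}$ means $p_{\max}\le n^{-\alpha+\varepsilon_n}$ for some deterministic sequence $\varepsilon_n\to0$. *)

(* Defs.v *)
From HB Require Import structures.
From mathcomp Require Import all_boot all_order all_algebra all_fingroup.
From mathcomp Require Import all_classical all_reals all_analysis.

Set Implicit Arguments.
Unset Strict Implicit.
Unset Printing Implicit Defensive.

Import Order.TTheory GRing.Theory Num.Theory.

Local Open Scope ring_scope.

(* A finite simple graph whose vertex set is a subset of T: a pair made of the
   vertex set and of the set of arcs, the latter containing both orientations
   (x, y) and (y, x) of every edge. *)
Definition graph_wf (T : finType) (g : {set T} * {set T * T}) : bool :=
  [forall x, forall y, ((x, y) \in g.2) ==>
    [&& x \in g.1, y \in g.1, x != y & (y, x) \in g.2]].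

Record graph (T : finType) := Graph {
  graph_val :> {set T} * {set T * T};
  graph_valP : graph_wf graph_val }.

HB.instance Definition _ (T : finType) := [isSub for @graph_val T].
HB.instance Definition _ (T : finType) := [Countable of graph T by <:].
HB.instance Definition _ (T : finType) := [Finite of graph T by <:].

Section Graphs.
Variable T : finType.
Implicit Types (G H : graph T) (x y : T) (k : nat).

Definition vset G : {set T} := (graph_val G).1.
Definition adj G x y : bool := (x, y) \in (graph_val G).2.

Definition subgraph H G : bool :=
  (vset H \subset vset G) && [forall x, forall y, adj H x y ==> adj G x y].

Definition degree G x : nat := #|[set y | adj G x y]|.

Definition min_degree_geq k G : bool :=
  [forall (x | x \in vset G), (k <= degree G x)%N].

Definition is_kcore k G H : bool :=
  [&& subgraph H G, min_degree_geq k H &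
      [forall H' : graph T,
        [&& subgraph H' G, min_degree_geq k H' & subgraph H H'] ==> (H' == H)]].

(* The default value G is never used, see is_kcore_kcore below. *)
Definition kcore k G : graph T := odflt G [pick H | is_kcore k G H].

Lemma graphP G x y : adj G x y ->
  [/\ x \in vset G, y \in vset G, x != y & adj G y x].
Proof.
by move=> Gxy; have /forallP/(_ x)/forallP/(_ y)/implyP/(_ Gxy)/and4P := graph_valP G.
Qed.

Lemma subgraphP H G :
  reflect ({subset vset H <= vset G} /\ forall x y, adj H x y -> adj G x y)
          (subgraph H G).
Proof.
apply: (iffP andP) => -[sHG eHG]; split; first exact/fintype.subsetP.
- by move=> x y; have /forallP/(_ x)/forallP/(_ y)/implyP := eHG.
- exact/fintype.subsetP.
- by apply/forallP=> x; apply/forallP=> y; apply/implyP; apply: eHG.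
Qed.

Lemma subgraph_refl G : subgraph G G.
Proof. by apply/subgraphP; split. Qed.

Lemma subgraph_trans G H K : subgraph G H -> subgraph H K -> subgraph G K.
Proof.
move=> /subgraphP[v1 e1] /subgraphP[v2 e2]; apply/subgraphP; split.
  by move=> x /v1/v2.
by move=> x y /e1/e2.
Qed.

Lemma subgraph_anti G H : subgraph G H -> subgraph H G -> G = H.
Proof.
move=> /subgraphP[v1 e1] /subgraphP[v2 e2]; apply/val_inj => /=.
rewrite [LHS]surjective_pairing [RHS]surjective_pairing; congr pair.
  by apply/setP=> x; apply/idP/idP; [apply: v1 | apply: v2].
by apply/setP=> -[x y]; apply/idP/idP; [apply: e1 | apply: e2].
Qed.

(* Union of all the subgraphs of G of minimum degree at least k. *)
Let kunion_val k G : {set T} * {set T * T} :=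
  ([set x | [exists H : graph T,
      [&& subgraph H G, min_degree_geq k H & x \in vset H]]],
   [set u | [exists H : graph T,
      [&& subgraph H G, min_degree_geq k H & adj H u.1 u.2]]]).

Let kunion_wf k G : graph_wf (kunion_val k G).
Proof.
apply/forallP=> x; apply/forallP=> y; apply/implyP; rewrite !inE /=.
case/existsP=> H /and3P[sH dH /graphP[Hx Hy xy Hyx]].
apply/and4P; split=> //; apply/existsP; exists H; exact/and3P.
Qed.

Let kunion k G : graph T := Graph (kunion_wf k G).

Let sub_kunion k G H :
  subgraph H G -> min_degree_geq k H -> subgraph H (kunion k G).
Proof.
move=> sH dH; apply/subgraphP; split=> [x Hx|x y Hxy]; rewrite /adj inE /=;
  apply/existsP; exists H; exact/and3P.
Qed.

Let is_kcore_kunion k G : is_kcore k G (kunion k G).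
Proof.
apply/and3P; split.
- apply/subgraphP; split=> [x|x y]; rewrite /adj inE /=;
    case/existsP=> H /and3P[/subgraphP[v e] _]; [exact: v | exact: e].
- apply/forallP=> x; apply/implyP; rewrite inE /=.
  case/existsP=> H /and3P[sH dH Hx].
  have /forallP/(_ x)/implyP/(_ Hx) le_k := dH.
  apply: (leq_trans le_k); apply/subset_leq_card/fintype.subsetP=> y.
  rewrite !inE; have /subgraphP[_ e] := sub_kunion sH dH; exact: e.
- apply/forallP=> H; apply/implyP=> /and3P[sH dH lH]; apply/eqP.
  exact: subgraph_anti (sub_kunion sH dH) lH.
Qed.

Lemma is_kcore_kcore k G : is_kcore k G (kcore k G).
Proof.
rewrite /kcore; case: pickP => [//|/(_ (kunion k G))].
by rewrite is_kcore_kunion.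
Qed.

Lemma kcore_greatest k G H :
  subgraph H G -> min_degree_geq k H -> subgraph H (kcore k G).
Proof.
move=> sH dH; have /and3P[sK dK /forallP/(_ (kunion k G))] := is_kcore_kcore k G.
have /and3P[sU dU _] := is_kcore_kunion k G.
by rewrite sU dU sub_kunion //= => /eqP <-; exact: sub_kunion.
Qed.

(* The graph {pi x, pi y} : {x, y} an edge of G *)
Let relabel_val (pi : {perm T}) G : {set T} * {set T * T} :=
  (pi @: vset G, [set (pi u.1, pi u.2) | u in (graph_val G).2]).

Let relabel_wf pi G : graph_wf (relabel_val pi G).
Proof.
apply/forallP=> x; apply/forallP=> y; apply/implyP.
case/imsetP=> -[a b] /= /graphP[Ga Gb ab Gba] [-> ->].
rewrite !imset_f //= (inj_eq perm_inj) ab /=.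
by apply/imsetP; exists (b, a).
Qed.

Definition relabel pi G : graph T := Graph (relabel_wf pi G).

Lemma adj_relabel pi G x y : adj (relabel pi G) (pi x) (pi y) = adj G x y.
Proof.
apply/imsetP/idP => [[[a b] /= Gab [/perm_inj -> /perm_inj -> //]]|Gxy].
by exists (x, y).
Qed.

End Graphs.

Section Matchings.
Variable n : nat.
Implicit Types (G : graph 'I_n) (M : {set 'I_n}) (mu : 'I_n -> 'I_n).

Let wedge_val G1 G2 M mu : {set 'I_n} * {set 'I_n * 'I_n} :=
  (M, [set u | [&& u.1 \in M, u.2 \in M, adj G1 u.1 u.2
                 & adj G2 (mu u.1) (mu u.2)]]).

Let wedge_wf G1 G2 M mu : graph_wf (wedge_val G1 G2 M mu).
Proof.
apply/forallP=> x; apply/forallP=> y; apply/implyP; rewrite !inE /=.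
by case/and4P=> -> -> /graphP[_ _ -> ->] /graphP[_ _ _ ->].
Qed.

(* mu is only used on M. *)
Definition wedge G1 G2 M mu : graph 'I_n := Graph (wedge_wf G1 G2 M mu).

(* An injection M -> [n] is given by a total map, whose values outside M are
   irrelevant. *)
Record matching := Matching {
  mdom : {set 'I_n};
  mmap : 'I_n -> 'I_n;
  mmap_inj : {in mdom &, injective mmap} }.

Definition kcore_matching (k : nat) G1 G2 (m : matching) : bool :=
  min_degree_geq k (wedge G1 G2 (mdom m) (mmap m)).

Definition kcore_estimator (k : nat) G1 G2 (m : matching) : Prop :=
  kcore_matching k G1 G2 m /\
  forall m' : matching, kcore_matching k G1 G2 m' -> (#|mdom m'| <= #|mdom m|)%N.

Definition graph_on mu (S : {set 'I_n}) : {set 'I_n * 'I_n} :=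
  [set (i, mu i) | i in S].

End Matchings.

Section RandomGraphs.
Variables (R : realType) (n : nat).
Implicit Types (p : 'I_n -> 'I_n -> R) (s : R) (G : graph 'I_n).

Definition edge_probabilities p : Prop :=
  [/\ forall i j, 0 <= p i j <= 1, forall i j, p i j = p j i
    & forall i, p i i = 0].

(* For edge probabilities the neutral element 0 does not change the maximum. *)
Definition pmax p : R := \big[Order.max/0]_(i < n) \big[Order.max/0]_(j < n) p i j.

(* Probability mass function of the inhomogeneous random graph on [n]. *)
Definition irg_pmf p G : R :=
  if vset G == [set: 'I_n] then
    \prod_(i < n) \prod_(j < n | (i < j)%N) (if adj G i j then p i j else 1 - p i j)
  else 0.

(* Keeping each edge of G independently with probability s amounts to sampling
   an inhomogeneous random graph with the parameter below. *)
Definition subsampling s G : 'I_n -> 'I_n -> R :=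
  fun i j => if adj G i j then s else 0.

(* The latent variables (G, G_1, G_2', pi_* ). *)
Definition outcome : finType :=
  (graph 'I_n * graph 'I_n * graph 'I_n * {perm 'I_n})%type.

Definition parent_graph (w : outcome) : graph 'I_n := w.1.1.1.
Definition graph1 (w : outcome) : graph 'I_n := w.1.1.2.
Definition graph2' (w : outcome) : graph 'I_n := w.1.2.
Definition latent_perm (w : outcome) : {perm 'I_n} := w.2.
Definition graph2 (w : outcome) : graph 'I_n :=
  relabel (latent_perm w) (graph2' w).

Definition correlated_irg_pmf p s (w : outcome) : R :=
  irg_pmf p (parent_graph w)
  * irg_pmf (subsampling s (parent_graph w)) (graph1 w)
  * irg_pmf (subsampling s (parent_graph w)) (graph2' w)
  * (n`!%:R)^-1.

Definition Pr p s (A : {set outcome}) : R :=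
  \sum_(w in A) correlated_irg_pmf p s w.

Definition core_recovery (k : nat) (est : outcome -> matching n) : {set outcome} :=
  [set w |
    let M := mdom (est w) in
    let true_wedge := wedge (graph1 w) (graph2 w) [set: 'I_n] (latent_perm w) in
    (M == vset (kcore k true_wedge))
    && (graph_on (mmap (est w)) M == graph_on (latent_perm w) M)].

Let f_val (f : {ffun 'I_n * 'I_n -> bool}) : {set 'I_n} * {set 'I_n * 'I_n} :=
  ([set: 'I_n],
   [set u : 'I_n * 'I_n | if (u.1 < u.2)%N then f u else (u.2 < u.1)%N && f (u.2, u.1)]).

Let f_wf f : graph_wf (f_val f).
Proof.
apply/forallP=> x; apply/forallP=> y; apply/implyP; rewrite !inE /= -val_eqE /=.
by case: ltngtP.
Qed.

Let fg f : graph 'I_n := Graph (f_wf f).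

Let gf G : {ffun 'I_n * 'I_n -> bool} := [ffun u : 'I_n * 'I_n => (u.1 < u.2)%N && adj G u.1 u.2].

Lemma irg_pmf_sum1 p : \sum_G irg_pmf p G = 1.
Proof.
rewrite /irg_pmf -big_mkcond /=.
pose P := [pred u : 'I_n * 'I_n | (u.1 < u.2)%N].
pose F (u : 'I_n * 'I_n) (b : bool) : R := if b then p u.1 u.2 else 1 - p u.1 u.2.
transitivity (\prod_(u | P u) \sum_(b : bool) F u b); last first.
  by rewrite big1 // => u _; rewrite big_bool /F /= subrKC.
rewrite (big_distr_big false) /=.
rewrite [RHS](reindex_onto gf fg); last first.
  move=> f /pfamilyP[/fintype.subsetP sf _]; apply/ffunP=> -[i j]; rewrite ffunE /adj inE /=.
  case: ifP => // ij; apply/esym/negbTE/negP => fij.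
  by have := sf (i, j); rewrite !inE /= fij ij => /(_ isT).
apply: eq_big => G.
  apply/eqP/andP => [vG|[_ /eqP <-] //]; split.
    apply/pfamilyP; split=> [|//]; apply/fintype.subsetP=> u; rewrite !inE ffunE.
    by case: (_ < _)%N.
  apply/eqP/subgraph_anti; apply/subgraphP; rewrite vG; split=> // x y.
    rewrite {1}/adj inE /= !ffunE /=; case: ltngtP => //= _.
    by case/graphP.
  move=> Gxy; have [_ _ xy Gyx] := graphP Gxy.
  rewrite {1}/adj inE /= !ffunE /= Gyx Gxy.
  by move: xy; rewrite -val_eqE /=; case: ltngtP.
move=> _; rewrite pair_big_dep /=; apply: eq_bigr => -[i j] /= ij.
by rewrite /F ffunE /= ij.
Qed.

Lemma correlated_irg_pmf_sum1 p s : \sum_w correlated_irg_pmf p s w = 1.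
Proof.
rewrite /correlated_irg_pmf /parent_graph /graph1 /graph2'.
transitivity (\sum_(G : graph 'I_n) \sum_(G1 : graph 'I_n) \sum_(G2 : graph 'I_n)
   \sum_(pi : {perm 'I_n}) irg_pmf p G * irg_pmf (subsampling s G) G1
   * irg_pmf (subsampling s G) G2 * (n`!%:R)^-1).
  by rewrite !pair_bigA.
have permn : \sum_(pi : {perm 'I_n}) (n`!%:R)^-1 = 1 :> R.
  have <- : #|{: {perm 'I_n}}| = n`!.
    have := card_perm [set: 'I_n]; rewrite cardsT card_ord => <-; apply: eq_card => x.
    by rewrite !inE; apply/esym/fintype.subsetP=> y; rewrite inE.
  rewrite sumr_const -[LHS]mulr_natr mulVf // pnatr_eq0 -lt0n.
  by apply/card_gt0P; exists 1%g.
apply: (etrans _ (irg_pmf_sum1 p)); apply: eq_bigr => G _.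
under eq_bigr => G1 _.
  under eq_bigr => G2 _ do rewrite -mulr_sumr permn mulr1.
  rewrite -mulr_sumr irg_pmf_sum1 mulr1; over.
by rewrite -mulr_sumr irg_pmf_sum1 mulr1.
Qed.

End RandomGraphs.

(* Main.v *)
Require Import Defs.
From mathcomp Require Import all_boot all_order all_algebra all_fingroup.
From mathcomp Require Import all_classical all_reals all_analysis.
From mathcomp Require Import ring lra zify.
From mathcomp Require Import fintype finset.

Set Implicit Arguments.
Unset Strict Implicit.
Unset Printing Implicit Defensive.

Import Order.TTheory GRing.Theory Num.Theory.
Import numFieldNormedType.Exports.

Local Open Scope ring_scope.

(** Write nu for the inverse of the latent permutation composed with the
    estimated matching, a map on the matched set M, extended by the identity off
    M, and let D be the set of displaced points, those with nu x <> x.  If D is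
    empty, the estimator is a k-core matching that agrees with the truth, hence
    lies in the k-core of the true intersection graph; that k-core is itself a
    k-core matching, so maximality forces equality (recovers_of_agree).

    Suppose D is not empty.  Both observed graphs are subgraphs of the parent
    graph G, so every edge e of the intersection graph along the estimated
    matching gives two edges e and nu(e) of G.  Each of the points of D has
    degree at least k there, so at least k|D|/2 edges e meet D.  The edge map
    induced by nu is injective, so the graph that links e to nu(e) is made of
    paths and cycles, and a third of these edges can be selected such that no
    selected edge is the image of another one (exists_independent_third).  A
    selected set S has at least k|D|/6 edges and G contains S and its image
    (exists_witness, recovers_or_witness).

    The edges of G being independent, with p_ij <= q, this has probability at
    most the product over S of the weights q^2, or q for an edge fixed by nu
    (prob_witness_le).  There are at most 2n|D| edges that meet D, and at most
    |D| fixed ones, as these join two points exchanged by nu.  The total weight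
    is thus at most |D|(2nq^2 + q) (sum_weight_le).  If 2nq^2 + q <= Y^6 with
    Y <= 1, dividing each weight by Y^6 bounds the sum over all S by
    (e Y^k)^|D| (sum_witness_le), and the sum of z^|D| over all maps
    nu <> id is at most exp(n^2 z) - 1 because it factors over the points
    (sum_displaced_le).  Failure has probability at most exp(n^2 e Y^k) - 1.

    With q = n^(-alpha + o(1)), where alpha <= 1, the sum 2nq^2 + q is
    n^(1 - 2 alpha + o(1)).  Hence Y = n^(-gamma) is allowed for
    any gamma with 6 gamma < 2 alpha - 1, and n^2 Y^k tends to 0 as soon as
    gamma k > 2.  Both constraints on gamma can be met exactly when
    k > 12 / (2 alpha - 1). *)

(** * Independent sets of a partial injection *)

(** A maximal set A in which no point is the image of another one works:
    by maximality every other point of S is the image of a point of A or is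
    mapped into A, and by injectivity each alternative holds for at most
    #|A| points. *)
Lemma exists_independent_third (T : finType) (f : T -> T) (S : {set T}) :
  {in S &, injective f} ->
  exists A : {set T}, [/\ A \subset S,
    {in A &, forall x y, f x = y -> x = y} & (#|S| <= 3 * #|A|)%N].
Proof.
move=> f_inj.
pose indep (A : {set T}) := (A \subset S) &&
  [forall x in A, forall y in A, (f x == y) ==> (x == y)].
have indep0 : indep set0.
  by rewrite /indep sub0set; apply/forallP=> x; rewrite inE.
have [A /maxsetP[/andP[sAS /forall_inP A_indep] A_max] _] :=
  maxset_exists indep0.
have A_free : {in A &, forall x y, f x = y -> x = y}.
  move=> x y Ax Ay /eqP fxy.
  by have /forall_inP/(_ y Ay)/implyP/(_ fxy)/eqP := A_indep x Ax.
exists A; split=> //.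
pose B := [set x in S | f x \in A].
have le_B : (#|B| <= #|A|)%N.
  have /card_in_imset <- : {in B &, injective f}.
    by move=> x y; rewrite !inE => /andP[Sx _] /andP[Sy _]; exact: f_inj.
  by apply/subset_leq_card/fintype.subsetP=> _ /imsetP[x + ->];
    rewrite inE => /andP[].
have le_fA : (#|f @: A| <= #|A|)%N := leq_imset_card f A.
suff sS : S \subset A :|: (f @: A) :|: B.
  have := leq_trans (subset_leq_card sS) (leq_card_setU _ _).1.
  have := (leq_card_setU A (f @: A)).1; lia.
apply/fintype.subsetP=> x Sx; apply/negPn/negP.
rewrite !inE Sx /= !negb_or => /andP[/andP[Ax fAx] fxA].
have /A_max/(_ (subsetUr _ _)) xA : indep (x |: A).
  rewrite /indep subUset sub1set Sx sAS /=.
  apply/forall_inP => y /setU1P[->|Ay]; apply/forall_inP => z /setU1P[->|Az].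
  - exact/implyP.
  - by apply/implyP => /eqP fz; rewrite fz Az in fxA.
  - by apply/implyP => /eqP fy; rewrite -fy imset_f in fAx.
  - by apply/implyP => /eqP /(A_free _ _ Ay Az) ->.
by rewrite -xA setU11 in Ax.
Qed.

(** * Edge probabilities *)

Lemma union_bound (R : numDomainType) (I T : finType) (Q : pred T)
    (P : I -> pred T) (J : pred I) (F : T -> R) :
  (forall x, 0 <= F x) ->
  (forall x, Q x -> exists2 i, J i & P i x) ->
  \sum_(x | Q x) F x <= \sum_(i | J i) \sum_(x | P i x) F x.
Proof.
move=> F_ge0 QP; under [leRHS]eq_bigr => i _ do rewrite big_mkcond.
rewrite exchange_big big_mkcond /=; apply: ler_sum => x _.
have P_ge0 i : 0 <= if P i x then F x else 0 by case: ifP.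
case: ifP => [/QP[i Ji Pix]|_]; last exact: sumr_ge0.
by rewrite (bigD1 i) //= Pix lerDl sumr_ge0.
Qed.

Section GraphProbability.
Variables (R : realType) (n : nat).
Implicit Types (p : 'I_n -> 'I_n -> R) (G H : graph 'I_n).
Implicit Types (T : {set 'I_n * 'I_n}).

Definition edge_pairs : {set 'I_n * 'I_n} :=
  [set u : 'I_n * 'I_n | (u.1 < u.2)%N].

Definition contains T G : bool := [forall u in T, adj G u.1 u.2].

Lemma irg_pmfE p G : vset G = [set: 'I_n] ->
  irg_pmf p G =
  \prod_(u in edge_pairs) (if adj G u.1 u.2 then p u.1 u.2 else 1 - p u.1 u.2).
Proof.
move=> vG; rewrite /irg_pmf vG eqxx pair_big_dep /=.
by apply: eq_bigl => u; rewrite inE.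
Qed.

Lemma irg_pmf_ge0 p G : (forall i j, 0 <= p i j <= 1) -> 0 <= irg_pmf p G.
Proof.
move=> p01; rewrite /irg_pmf; case: ifP => // _.
apply: prodr_ge0 => i _; apply: prodr_ge0 => j _.
by have /andP[p0 p1] := p01 i j; case: ifP => // _; rewrite subr_ge0.
Qed.

(** Raise to 1 the parameters of the edges in T.  The mass function of
    the new random graph, multiplied by the product of the old parameters over
    T, is the old mass function restricted to the graphs that contain T; and
    the new one sums to 1. *)
Lemma sum_irg_pmf_contains p T : T \subset edge_pairs ->
  \sum_(G | contains T G) irg_pmf p G = \prod_(u in T) p u.1 u.2.
Proof.
move=> /fintype.subsetP sT.
pose p' i j := if (i, j) \in T then 1 else p i j.
rewrite -[RHS]mulr1 -[X in _ = _ * X](irg_pmf_sum1 p') mulr_sumr big_mkcond /=.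
apply: eq_bigr => G _.
have [vG|vG] := eqVneq (vset G) [set: 'I_n]; last first.
  by rewrite /irg_pmf (negbTE vG) mulr0 if_same.
rewrite !irg_pmfE //.
case: ifPn => [/forall_inP TG|/forall_inPn[u uT Gu]]; last first.
  have uE := sT u uT.
  rewrite [X in _ * X](bigD1 u) //= (negbTE Gu) /p' -surjective_pairing uT.
  by rewrite subrr mul0r mulr0.
have -> : \prod_(u in T) p u.1 u.2 =
    \prod_(u in edge_pairs) (if u \in T then p u.1 u.2 else 1).
  rewrite -big_mkcondr; apply: eq_bigl => u /=.
  by case: (boolP (u \in T)) => [/sT ->|]; rewrite ?andbF.
rewrite -big_split; apply: eq_bigr => u _ /=; rewrite /p' -surjective_pairing.
by case: (boolP (u \in T)) => [/TG ->|_]; rewrite ?mulr1 ?mul1r.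
Qed.

Lemma prob_contains_le p (q : R) T : T \subset edge_pairs ->
  (forall i j, 0 <= p i j <= q) ->
  \sum_(G | contains T G) irg_pmf p G <= q ^+ #|T|.
Proof.
move=> sT pq; rewrite sum_irg_pmf_contains // -prodr_const.
by apply: ler_prod => u _; exact: pq.
Qed.

(** An edge of H outside G would contribute a factor 0. *)
Lemma subsampling_sub (s : R) G H :
  irg_pmf (subsampling s G) H != 0 -> forall i j, adj H i j -> adj G i j.
Proof.
rewrite /irg_pmf; case: ifP => [_|_ /eqP//] /prodf_neq0 H0.
have Hlt (i j : 'I_n) : (i < j)%N -> adj H i j -> adj G i j.
  move=> ij Hij; have /prodf_neq0/(_ j ij) := H0 i isT.
  by rewrite Hij /subsampling; case: ifP => // _ /eqP.
move=> i j Hij; have [_ _ + Hji] := graphP Hij.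
rewrite -val_eqE /=; case: (ltngtP i j) => // [ij _|ji _]; first exact: Hlt.
by have [] := graphP (Hlt _ _ ji Hji).
Qed.

End GraphProbability.

Section CorrelatedGraphs.
Variables (R : realType) (n : nat) (p : 'I_n -> 'I_n -> R) (s : R).
Hypotheses (p01 : forall i j, 0 <= p i j <= 1) (s01 : 0 <= s <= 1).

Lemma subsampling01 (G : graph 'I_n) i j : 0 <= subsampling s G i j <= 1.
Proof. by rewrite /subsampling; case: ifP; rewrite ?lexx ?ler01. Qed.

Lemma correlated_irg_pmf_ge0 w : 0 <= correlated_irg_pmf p s w.
Proof.
by rewrite !mulr_ge0 ?invr_ge0 ?ler0n ?irg_pmf_ge0 //; exact: subsampling01.
Qed.

Lemma correlated_irg_pmf_sub w : correlated_irg_pmf p s w != 0 ->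
  (forall i j, adj (graph1 w) i j -> adj (parent_graph w) i j) /\
  (forall i j, adj (graph2' w) i j -> adj (parent_graph w) i j).
Proof.
rewrite /correlated_irg_pmf !mulf_eq0 !negb_or => /andP[/andP[/andP[_ h1] h2] _].
by split; [exact: subsampling_sub h1 | exact: subsampling_sub h2].
Qed.

Lemma Pr_le1 (A : {set outcome n}) : Pr p s A <= 1.
Proof.
rewrite -(correlated_irg_pmf_sum1 p s) [leRHS](bigID (mem A)) /= lerDl.
by apply: sumr_ge0 => w _; exact: correlated_irg_pmf_ge0.
Qed.

(** The subsampled graphs and the permutation integrate out, whatever the
    parent graph is. *)
Lemma sum_pmf_parent (B : pred (graph 'I_n)) :
  \sum_(w | B (parent_graph w)) correlated_irg_pmf p s w =
  \sum_(G | B G) irg_pmf p G.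
Proof.
transitivity (\sum_(G | B G) \sum_(G1 : graph 'I_n) \sum_(G2 : graph 'I_n)
  \sum_(pi : {perm 'I_n}) irg_pmf p G * irg_pmf (subsampling s G) G1
    * irg_pmf (subsampling s G) G2 * (n`!%:R)^-1).
  rewrite pair_big_dep pair_big_dep pair_big_dep /=.
  by apply: eq_big => [w|//]; rewrite !andbT.
apply: eq_bigr => G _.
have sum_perm : \sum_(pi : {perm 'I_n}) (n`!%:R)^-1 = 1 :> R.
  by rewrite sumr_const card_Sn -[LHS]mulr_natr mulVf // pnatr_eq0 -lt0n fact_gt0.
under eq_bigr => G1 _.
  under eq_bigr => G2 _ do rewrite -mulr_sumr sum_perm mulr1.
  rewrite -mulr_sumr irg_pmf_sum1 mulr1; over.
by rewrite -mulr_sumr irg_pmf_sum1 mulr1.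
Qed.

End CorrelatedGraphs.

(** * Displaced edges and their images *)

Section EdgeMap.
Variable n : nat.
Implicit Types (G : graph 'I_n) (u v : 'I_n * 'I_n) (nu : 'I_n -> 'I_n).
Implicit Types (D M : {set 'I_n}) (S : {set 'I_n * 'I_n}).

Definition swap_pair u := (u.2, u.1).

(** Unordered pairs of distinct vertices are represented by their increasing
    orderings, the set edge_pairs. *)
Definition sort_pair u := if (u.1 < u.2)%N then u else swap_pair u.

Definition edge_map nu u := sort_pair (nu u.1, nu u.2).

Definition displaced nu : {set 'I_n} := [set x | nu x != x].

Definition touching nu : {set 'I_n * 'I_n} :=
  [set u in edge_pairs n | (u.1 \in displaced nu) || (u.2 \in displaced nu)].

Lemma adjC G x y : adj G x y = adj G y x.
Proof. by apply/idP/idP => /graphP[]. Qed.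

Variant sort_pair_spec u : 'I_n * 'I_n -> Prop :=
  | SortPairId : sort_pair_spec u u
  | SortPairSwap : sort_pair_spec u (swap_pair u).

Lemma sort_pairP u : sort_pair_spec u (sort_pair u).
Proof. by rewrite /sort_pair; case: ifP => _; constructor. Qed.

Lemma sort_pair_edge u : u.1 != u.2 -> sort_pair u \in edge_pairs n.
Proof.
rewrite -val_eqE inE /sort_pair /=; case: ifP => //=; case: ltngtP => //.
Qed.

Lemma adj_sort_pair G u : adj G (sort_pair u).1 (sort_pair u).2 = adj G u.1 u.2.
Proof. by case: sort_pairP => //=; rewrite adjC. Qed.

Lemma edge_map_inj nu M : {in M &, injective nu} ->
  {in [set u in edge_pairs n | (u.1 \in M) && (u.2 \in M)] &,
    injective (edge_map nu)}.
Proof.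
move=> nu_inj [a b] [c d] /[!inE] /and3P[/= ab aM bM] /and3P[/= cd cM dM].
have straight : nu a = nu c -> nu b = nu d -> (a, b) = (c, d).
  by move=> /(nu_inj _ _ aM cM) -> /(nu_inj _ _ bM dM) ->.
have crossed : nu a = nu d -> nu b = nu c -> (a, b) = (c, d).
  move=> /(nu_inj _ _ aM dM) ad /(nu_inj _ _ bM cM) bc.
  by move: ab; rewrite ad bc ltnNge (ltnW cd).
rewrite /edge_map; case: sort_pairP; case: sort_pairP => -[? ?].
- exact: straight.
- exact: crossed.
- by apply: crossed.
- exact: straight.
Qed.

(** An upper bound for the probability that an edge and its image are both
    present; an edge fixed by the edge map has to be present only once. *)
Definition weight (R : realType) (q : R) nu u : R :=
  if edge_map nu u == u then q else q ^+ 2.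

(** The independence condition makes the sets S and edge_map nu @: S
    disjoint up to fixed edges, so that no edge of their union is counted in
    the weight of two different elements of S.  The factor 6 comes from
    choosing one edge in three, after halving the sum of the degrees. *)
Record witness (k : nat) nu S : Prop := Witness {
  witness_touching : S \subset touching nu;
  witness_image : edge_map nu @: S \subset edge_pairs n;
  witness_inj : {in S &, injective (edge_map nu)};
  witness_indep : {in S &, forall u v, edge_map nu u = v -> u = v};
  witness_large : (k * #|displaced nu| <= 6 * #|S|)%N }.

(** Summing the degrees over the displaced points counts every edge at most
    twice; a third of the edges so obtained is independent. *)
Lemma exists_witness k nu M G :
  {in M &, injective nu} -> {in displaced nu, forall x, x \in M} ->
  {in displaced nu, forall x,
     (k <= #|[set y in M | adj G x y && adj G (nu x) (nu y)]|)%N} ->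
  exists2 S, witness k nu S & contains (S :|: edge_map nu @: S) G.
Proof.
move=> nu_inj DM deg_k; set D := displaced nu in DM deg_k *.
pose nbh x := [set y in M | adj G x y && adj G (nu x) (nu y)].
(* Arcs and not edges: an edge with both ends displaced counts in the degrees
   of both. *)
pose N : {set 'I_n * 'I_n} :=
  [set u : 'I_n * 'I_n | (u.1 \in D) && (u.2 \in nbh u.1)].
have N_large : (k * #|D| <= #|N|)%N.
  have -> : #|N| = (\sum_(x in D) #|nbh x|)%N.
    under [RHS]eq_bigr => x _ do rewrite -sum1_card.
    by rewrite pair_big_dep /= sum1_card; apply: eq_card => u; rewrite in_set.
  by rewrite mulnC -sum_nat_const; apply: leq_sum => x /deg_k.
pose S : {set 'I_n * 'I_n} := sort_pair @: N.
have S_large : (#|N| <= 2 * #|S|)%N.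
  suff sN : N \subset S :|: swap_pair @: S.
    apply: (leq_trans (subset_leq_card sN)).
    apply: (leq_trans (leq_card_setU _ _).1).
    by rewrite mul2n -addnn leq_add2l leq_imset_card.
  apply/fintype.subsetP=> u uN; have := imset_f sort_pair uN.
  rewrite -/S inE; case: sort_pairP => [-> //|Su]; apply/orP; right.
  by apply/imsetP; exists (swap_pair u) => //; case: (u).
have SP u : u \in S -> [/\ u \in edge_pairs n, (u.1 \in M) && (u.2 \in M),
    (u.1 \in D) || (u.2 \in D), adj G u.1 u.2 & adj G (nu u.1) (nu u.2)].
  case/imsetP=> v; rewrite in_set => /andP[vD].
  rewrite in_set => /and3P[vM Gv Gnv] ->.
  have [_ _ v12 _] := graphP Gv.
  move: (sort_pair_edge v12); rewrite adj_sort_pair.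
  by case: sort_pairP => /= ?; rewrite vD vM (DM _ vD) ?orbT; split=> //; rewrite adjC.
have S_inj : {in S &, injective (edge_map nu)}.
  move=> u v /SP[uE uM _ _ _] /SP[vE vM _ _ _].
  by apply: (edge_map_inj nu_inj); rewrite in_set ?uE ?vE ?uM ?vM.
have [A [sAS A_indep A_large]] := exists_independent_third S_inj.
move/fintype.subsetP: (sAS) => AS.
exists A; last first.
  apply/forall_inP=> u /setUP[/AS/SP[]//|/imsetP[v /AS/SP[_ _ _ _ Gv] ->]].
  by rewrite adj_sort_pair.
split=> //.
- apply/fintype.subsetP=> u /AS/SP[uE _ uD _ _]; rewrite in_set uE /=; exact: uD.
- apply/fintype.subsetP=> _ /imsetP[u /AS/SP[_ _ _ _ /graphP[_ _ Gu _]] ->].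
  exact: sort_pair_edge.
- by move=> u v /AS Su /AS Sv; exact: S_inj.
- by rewrite -/D; lia.
Qed.

Section WitnessProbability.
Variables (R : realType) (p : 'I_n -> 'I_n -> R) (q : R).
Hypothesis pq : forall i j, 0 <= p i j <= q.

(** The number of distinct edges required is #|S| plus the number of elements
    of S that the edge map does not fix, and this is also the exponent of q in
    the product of the weights. *)
Lemma prob_witness_le k nu S : 0 <= q -> witness k nu S ->
  \sum_(G | contains (S :|: edge_map nu @: S) G) irg_pmf p G
    <= \prod_(u in S) weight q nu u.
Proof.
move=> q_ge0 [S_touch S_img S_inj S_indep _].
have sSE : S \subset edge_pairs n.
  by apply/(subset_trans S_touch)/fintype.subsetP => u; rewrite inE => /andP[].
pose S1 := [set u in S | edge_map nu u != u].
have -> : \prod_(u in S) weight q nu u = q ^+ (#|S| + #|S1|).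
  rewrite exprD -!prodr_const [X in _ * X](eq_bigl
    (fun u => (u \in S) && (edge_map nu u != u))); last by move=> u; rewrite inE.
  rewrite [X in _ * X]big_mkcondr -big_split; apply: eq_bigr => u _ /=.
  by rewrite /weight; case: eqP; rewrite ?mulr1.
have -> : (#|S| + #|S1|)%N = #|S :|: edge_map nu @: S|.
  have <- : #|edge_map nu @: S1| = #|S1|.
    apply: card_in_imset => u v; rewrite !inE => /andP[uS _] /andP[vS _].
    exact: S_inj.
  have -> : S :|: edge_map nu @: S = S :|: edge_map nu @: S1.
    apply/setP=> v; rewrite !in_setU; case: (boolP (v \in S)) => //= vS.
    apply/imsetP/imsetP => -[u uS def_v]; exists u => //.
      by rewrite inE uS; apply: contraNneq vS => u_fix; rewrite def_v u_fix.
    by move: uS; rewrite inE => /andP[].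
  rewrite cardsU (_ : S :&: _ = set0) ?cards0 ?subn0 //.
  apply/setP=> v; rewrite !inE; apply/negP=> /andP[vS /imsetP[u + def_v]].
  rewrite inE => /andP[uS /eqP[]]; rewrite -def_v.
  by apply/esym/S_indep.
by apply: prob_contains_le pq; rewrite subUset sSE.
Qed.

End WitnessProbability.

(** At most 2n#|D| edges have an end in the displaced set D.  A fixed edge with
    an end in D has both its ends exchanged by nu, so it is determined by its
    first end, which is in D. *)
Lemma sum_weight_le (R : realType) (q : R) nu : 0 <= q ->
  \sum_(u in touching nu) weight q nu u
    <= #|displaced nu|%:R * (2 * n%:R * q ^+ 2 + q).
Proof.
move=> q_ge0; set D := displaced nu.
have q2_ge0 : 0 <= q ^+ 2 by exact: exprn_ge0.
pose F := [set u in touching nu | edge_map nu u == u].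
have wle u : weight q nu u <= q ^+ 2 + (if edge_map nu u == u then q else 0).
  by rewrite /weight; case: ifP => _; rewrite ?addr0 // lerDr.
apply: (le_trans (ler_sum _ (fun u _ => wle u))).
have fixed_sum : \sum_(u in touching nu) (if edge_map nu u == u then q else 0)
    = #|F|%:R * q.
  rewrite mulr_natl -big_mkcondr -sumr_const.
  by apply: eq_bigl => u; rewrite [RHS]in_set.
rewrite big_split fixed_sum sumr_const -[X in X + _ <= _]mulr_natl mulrDr.
apply: lerD.
  rewrite mulrA ler_wpM2r // mulrCA mulrA -!natrM ler_nat.
  have sT : touching nu \subset setX D [set: 'I_n] :|: setX [set: 'I_n] D.
    by apply/fintype.subsetP => u; rewrite !inE => /andP[_]; rewrite andbT.
  apply: (leq_trans (subset_leq_card sT)).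
  apply: (leq_trans (leq_card_setU _ _).1).
  by rewrite !cardsX cardsT card_ord [(n * _)%N]mulnC addnn -mul2n mulnA.
rewrite ler_wpM2r // ler_nat.
(* If both ends were fixed, neither would be displaced. *)
have FP u : u \in F -> u.1 \in D /\ u.2 = nu u.1.
  case: u => a b; rewrite !inE /= => /andP[/andP[ab abD]].
  rewrite /edge_map; case: sort_pairP => /eqP[nua nub].
    by rewrite nua nub !eqxx in abD.
  by rewrite -nub; split=> //; apply: contraTneq ab => nu_aa; rewrite -nub nu_aa ltnn.
have /card_in_imset <- : {in F &, injective (@fst 'I_n 'I_n)}.
  move=> [a b] [c d] /FP[/= _ ->] /FP[/= _ ->] /= -> //.
by apply/subset_leq_card/fintype.subsetP => _ /imsetP[u /FP[uD _] ->].
Qed.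

End EdgeMap.

(** * The union bound *)

(** The sum over all subsets of E is the product of the 1 + f u, and
    1 + x <= expR x. *)
Lemma sum_prod_subsets_le (R : realType) (T : finType) (E : {set T})
    (P : pred {set T}) (f : T -> R) :
  {in E, forall u, 0 <= f u} -> (forall S, P S -> S \subset E) ->
  \sum_(S | P S) \prod_(u in S) f u <= expR (\sum_(u in E) f u).
Proof.
move=> f_ge0 PE; pose F u := if u \in E then f u else 0.
have F_ge0 u : 0 <= F u by rewrite /F; case: ifP => // /f_ge0.
apply: (@le_trans _ _ (\prod_u (F u + 1))).
  rewrite bigA_distr big_mkcond /=; apply: ler_sum => S _.
  case: ifP => [/PE/fintype.subsetP SE|_]; last first.
    by apply: prodr_ge0 => u _; case: ifP.
  rewrite big_mkcond le_eqVlt; apply/orP/or_introl/eqP/eq_bigr => u _.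
  by rewrite /F; case: ifP => // /SE ->.
rewrite [X in expR X]big_mkcond expR_sum; apply: ler_prod => u _.
by rewrite addr_ge0 //= addrC expR_ge1Dx.
Qed.

Section UnionBound.
Variables (R : realType) (n : nat).
Implicit Types (q Y z : R) (nu : {ffun 'I_n -> 'I_n}).

(** A Chernoff bound: since S is large and Y <= 1, dividing each weight by
    Y ^+ 6 takes out a factor of at most Y ^+ (k * #|displaced nu|), and after the
    division the total weight is at most #|displaced nu|. *)
Lemma sum_witness_le q Y k (nu : 'I_n -> 'I_n) :
  0 <= q -> 0 < Y <= 1 -> 2 * n%:R * q ^+ 2 + q <= Y ^+ 6 ->
  \sum_(S | `[< witness k nu S >]) \prod_(u in S) weight q nu u
    <= (expR 1 * Y ^+ k) ^+ #|displaced nu|.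
Proof.
move=> q_ge0 /andP[Y_gt0 Y_le1] qY.
have Y6_gt0 : 0 < Y ^+ 6 by exact: exprn_gt0.
have w_ge0 u : 0 <= weight q nu u by rewrite /weight; case: ifP; rewrite ?exprn_ge0.
pose f u := weight q nu u / Y ^+ 6.
have f_ge0 u : 0 <= f u by rewrite divr_ge0 // ltW.
apply: (@le_trans _ _ (\sum_(S | `[< witness k nu S >])
    (Y ^+ k) ^+ #|displaced nu| * \prod_(u in S) f u)).
  apply: ler_sum => S /asboolP[_ _ _ _ S_large].
  have -> : \prod_(u in S) weight q nu u = Y ^+ (6 * #|S|) * \prod_(u in S) f u.
    rewrite exprM -prodr_const -big_split; apply: eq_bigr => u _.
    by rewrite /f /= mulrC divfK // gt_eqF.
  rewrite ler_wpM2r ?prodr_ge0 // -exprM.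
  by rewrite ler_wiXn2l // ltW.
rewrite -mulr_sumr exprMn mulrC ler_wpM2r ?exprn_ge0 ?(ltW Y_gt0) //.
apply: (le_trans (sum_prod_subsets_le (E := touching nu) _ _)) => //.
  by move=> S /asboolP[].
rewrite -expRM_natl mulr1 ler_expR -mulr_suml ler_pdivrMr //.
apply: (le_trans (sum_weight_le _ q_ge0)).
by rewrite ler_wpM2l.
Qed.

(** The sum of z ^+ #|displaced nu| over all maps factors as a product over the
    points x, each factor being 1 + (n - 1) z; the identity map contributes
    1. *)
Lemma sum_displaced_le z : 0 <= z ->
  \sum_(nu : {ffun 'I_n -> 'I_n} | nu != [ffun x => x]) z ^+ #|displaced nu|
    <= expR (n%:R ^+ 2 * z) - 1.
Proof.
move=> z_ge0; rewrite lerBrDr.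
have id_term : \sum_(nu : {ffun 'I_n -> 'I_n} | nu == [ffun x => x])
    z ^+ #|displaced nu| = 1.
  rewrite big_pred1_eq (_ : displaced _ = set0) ?cards0 //.
  by apply/setP=> x; rewrite !inE ffunE eqxx.
rewrite -[X in _ + X <= _]id_term addrC.
rewrite -(bigID (fun nu => nu == [ffun x => x]) predT) /=.
under eq_bigr => nu _.
  rewrite -prodr_const big_mkcond.
  under eq_bigr => x _ do rewrite inE.
  over.
rewrite -(bigA_distr_bigA (fun x y : 'I_n => if y != x then z else 1)) /=.
have row_le (x : 'I_n) :
    0 <= \sum_(y : 'I_n) (if y != x then z else 1) <= expR (n%:R * z).
  apply/andP; split; first by apply: sumr_ge0 => y _; case: ifP.
  rewrite (bigD1 x) //= eqxx /=; apply: le_trans (expR_ge1Dx _).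
  rewrite lerD2l mulr_natl -[X in _ *+ X](card_ord n) -sumr_const.
  by rewrite big_mkcond; apply: ler_sum => y _; do 2![case: ifP => //].
apply: (@le_trans _ _ (\prod_(x < n) expR (n%:R * z))).
  by apply: ler_prod => x _; exact: row_le.
by rewrite prodr_const card_ord -expRM_natl mulrA -expr2.
Qed.

End UnionBound.

(** * From a failure of the estimator to a witness *)

Section Recovery.
Variable n : nat.
Implicit Types (G : graph 'I_n) (w : outcome n).

Lemma adj_wedge G1 G2 (M : {set 'I_n}) mu x y :
  adj (wedge G1 G2 M mu) x y =
  [&& x \in M, y \in M, adj G1 x y & adj G2 (mu x) (mu y)].
Proof. by rewrite {1}/adj inE. Qed.

(** Membership in core_recovery, for a single outcome and a single
    matching. *)
Definition recovers k w (m : matching n) : bool :=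
  (mdom m == vset (kcore k
     (wedge (graph1 w) (graph2 w) [set: 'I_n] (latent_perm w))))
  && (graph_on (mmap m) (mdom m) == graph_on (latent_perm w) (mdom m)).

Lemma min_degree_kcore k G : min_degree_geq k (kcore k G).
Proof. by have /and3P[] := is_kcore_kcore k G. Qed.

(** The matched graph of m is then a subgraph of the true intersection graph
    with minimum degree at least k, so mdom m is contained in the vertex set of
    the k-core; as the latter with the latent permutation is also a k-core
    matching, it is not larger than mdom m. *)
Lemma recovers_of_agree k w m :
  kcore_estimator k (graph1 w) (graph2 w) m ->
  {in mdom m, mmap m =1 latent_perm w} -> recovers k w m.
Proof.
case=> m_core m_max m_true; set pi := latent_perm w in m_true *.
rewrite /recovers -/pi; set W := wedge _ _ [set: _] _; set C := kcore k W.
have -> : graph_on (mmap m) (mdom m) = graph_on pi (mdom m).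
  by apply: eq_in_imset => x /m_true ->.
rewrite eqxx andbT eqEcard; apply/andP; split.
  have sub_W : subgraph (wedge (graph1 w) (graph2 w) (mdom m) (mmap m)) W.
    apply/subgraphP; split=> [x _|x y]; first by rewrite in_setT.
    rewrite !adj_wedge => /and4P[xM yM ->].
    by rewrite !in_setT m_true // m_true.
  by have /subgraphP[/fintype.subsetP] := kcore_greatest sub_W m_core.
pose mC := @Matching n (vset C) pi (fun x y _ _ => @perm_inj _ pi x y).
apply: (m_max mC); apply/forall_inP => x xC.
have /forall_inP/(_ x xC) C_deg := min_degree_kcore k W.
apply: (leq_trans C_deg); apply/subset_leq_card/fintype.subsetP => y.
rewrite !inE => Cxy; have [_ yC _ _] := graphP Cxy.
have /and3P[/subgraphP[_ CW] _ _] := is_kcore_kcore k W.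
by have := CW _ _ Cxy; rewrite !adj_wedge !in_setT /= xC yC.
Qed.

(** Unless the estimator agrees with the latent permutation on its domain, the
    map nu comparing the two displaces some point, and the edges seen in the
    intersection graph are edges of the parent graph together with their
    images under nu. *)
Lemma recovers_or_witness k w m :
  (forall i j, adj (graph1 w) i j -> adj (parent_graph w) i j) ->
  (forall i j, adj (graph2' w) i j -> adj (parent_graph w) i j) ->
  kcore_estimator k (graph1 w) (graph2 w) m -> ~~ recovers k w m ->
  exists2 nu : {ffun 'I_n -> 'I_n}, nu != [ffun x => x] &
  exists2 S, witness k nu S & contains (S :|: edge_map nu @: S) (parent_graph w).
Proof.
move=> sub1 sub2 m_est m_fail; set pi := latent_perm w.
pose nu := [ffun x => if x \in mdom m then (pi^-1)%g (mmap m x) else x].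
have nuE : {in mdom m, forall x, pi (nu x) = mmap m x}.
  by move=> x xM; rewrite ffunE xM permKV.
exists nu.
  apply: contraNneq m_fail => nu_id; apply: recovers_of_agree => // x xM.
  by rewrite -nuE // nu_id ffunE.
apply: (@exists_witness _ _ _ (mdom m)).
- move=> x y xM yM nu_xy; apply: (@mmap_inj _ m) => //.
  by rewrite -!nuE // nu_xy.
- by move=> x; rewrite inE ffunE; case: ifP => //; rewrite eqxx.
- move=> x x_disp.
  have xM : x \in mdom m.
    by move: x_disp; rewrite inE ffunE; case: ifP => //; rewrite eqxx.
  have [/forall_inP/(_ x xM) deg_x _] := m_est.
  apply: (leq_trans deg_x); apply/subset_leq_card/fintype.subsetP => y.
  rewrite !inE adj_wedge => /and4P[_ yM /sub1 Gxy].
  rewrite -!nuE // /graph2 adj_relabel => /sub2 Gnu.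
  by rewrite yM Gxy.
Qed.

End Recovery.

(** The bound does not involve s: the failure event is contained in an event
    on the parent graph alone. *)
Lemma Pr_core_recovery_ge (R : realType) n (p : 'I_n -> 'I_n -> R) (s q Y : R) k
    (est : outcome n -> matching n) :
  (forall i j, 0 <= p i j <= 1) -> (forall i j, p i j <= q) -> 0 <= s <= 1 ->
  (forall w, kcore_estimator k (graph1 w) (graph2 w) (est w)) ->
  0 <= q -> 0 < Y <= 1 -> 2 * n%:R * q ^+ 2 + q <= Y ^+ 6 ->
  1 - (expR (n%:R ^+ 2 * (expR 1 * Y ^+ k)) - 1)
    <= Pr p s (core_recovery k est).
Proof.
move=> p01 p_le s01 est_ok q_ge0 Y01 qY; rewrite lerBlDr addrC -lerBlDr.
have pq i j : 0 <= p i j <= q by rewrite p_le andbT; case/andP: (p01 i j).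
pose ev (t : {ffun 'I_n -> 'I_n} * {set 'I_n * 'I_n}) G :=
  contains (t.2 :|: edge_map t.1 @: t.2) G.
pose idx (t : {ffun 'I_n -> 'I_n} * {set 'I_n * 'I_n}) :=
  (t.1 != [ffun x => x]) && `[< witness k t.1 t.2 >].
pose bad G := [exists t, idx t && ev t G].
have fail_le : 1 - Pr p s (core_recovery k est) <= \sum_(G | bad G) irg_pmf p G.
  rewrite -(correlated_irg_pmf_sum1 p s) (bigID (mem (core_recovery k est))) /=.
  rewrite addrAC subrr add0r -(sum_pmf_parent p s) big_mkcond [leRHS]big_mkcond.
  apply: ler_sum => w _.
  have pmf_ge0 := correlated_irg_pmf_ge0 p01 s01 w.
  case: ifPn => [w_fail|_]; last by case: ifP.
  have [->|/correlated_irg_pmf_sub[sub1 sub2]] :=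
    eqVneq (correlated_irg_pmf p s w) 0; first by rewrite if_same.
  have := recovers_or_witness sub1 sub2 (est_ok w).
  rewrite inE in w_fail => /(_ w_fail) [nu nu_id [S SW SG]].
  suff -> : bad (parent_graph w) by [].
  by apply/existsP; exists (nu, S); rewrite /idx /ev /= nu_id SG andbT; apply/asboolP.
apply: (le_trans fail_le).
apply: (le_trans (union_bound (J := idx) (P := ev) _ _)).
- by move=> G; exact: irg_pmf_ge0.
- by move=> G /existsP[t /andP[]]; exists t.
apply: (@le_trans _ _ (\sum_(t | idx t) \prod_(u in t.2) weight q t.1 u)).
  by apply: ler_sum => t /andP[_ /asboolP t_wit]; exact: (prob_witness_le pq q_ge0 t_wit).
rewrite -(pair_big_dep (fun nu => nu != [ffun x => x])
  (fun nu S => `[< witness k nu S >])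
  (fun nu S => \prod_(u in S) weight q nu u)) /=.
have z_ge0 : 0 <= expR 1 * Y ^+ k.
  by case/andP: Y01 => Y_gt0 _; rewrite mulr_ge0 ?expR_ge0 ?exprn_ge0 ?ltW.
apply: le_trans (sum_displaced_le n z_ge0).
by apply: ler_sum => nu _; exact: sum_witness_le.
Qed.

(** * Asymptotics *)

Section Asymptotics.
Local Open Scope classical_set_scope.
Variable R : realType.

Lemma powR_nat_ge (c d : R) : 0 < d -> \forall n \near \oo, c <= n%:R `^ d.
Proof.
move=> d_gt0; near=> n.
have n_ge : `|c| `^ d^-1 <= n%:R by near: n; exact: nbhs_infty_ger.
apply: (le_trans (ler_norm c)).
rewrite -[leLHS]powRr1 // -[X in `|c| `^ X](mulVf (lt0r_neq0 d_gt0)).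
by rewrite powRrM; apply: ge0_ler_powR; rewrite ?nnegrE ?powR_ge0 ?(ltW d_gt0).
Unshelve. all: by end_near. Qed.

Lemma powR_natN_cvg0 (d : R) : 0 < d -> (n%:R `^ (- d)) @[n --> \oo] --> (0 : R).
Proof.
move=> d_gt0; apply/cvgrPdist_le => e e_gt0; near=> n.
rewrite sub0r normrN ger0_norm ?powR_ge0 // powRN.
have n_ge : e^-1 <= n%:R `^ d by near: n; exact: powR_nat_ge.
rewrite -[leRHS]invrK lef_pV2 // posrE ?invr_gt0 //.
by apply: lt_le_trans n_ge; rewrite invr_gt0.
Unshelve. all: by end_near. Qed.

(** The exponents of n q ^+ 2 and of q are 1 - 2 alpha and - alpha, up to o(1);
    as alpha <= 1 the first one bounds the second one, and it is less than
    - 6 gamma.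
    The slack is shared between the o(1) and the constant 3 = 2 + 1. *)
Lemma edge_weight_bound (alpha gamma : R) (eps : nat -> R) :
  alpha <= 1 -> 6 * gamma < 2 * alpha - 1 -> eps n @[n --> \oo] --> (0 : R) ->
  \forall n \near \oo,
    2 * n%:R * (n%:R `^ (- alpha + eps n)) ^+ 2 + n%:R `^ (- alpha + eps n)
      <= (n%:R `^ (- gamma)) ^+ 6.
Proof.
move=> alpha1 gap eps0.
have [d dE] : exists d, d = (2 * alpha - 1 - 6 * gamma) / 2 by eexists.
have d_gt0 : 0 < d by lra.
have d2_gt0 : 0 < d / 2 by rewrite divr_gt0.
near=> n.
have n_ge1 : 1 <= n%:R :> R by near: n; exact: nbhs_infty_ger.
have n_gt0 : 0 < n%:R :> R by exact: lt_le_trans n_ge1.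
have nd_ge3 : 3 <= n%:R `^ d :> R by near: n; exact: powR_nat_ge.
have eps_le : `|eps n| <= d / 2.
  by near: n; move/cvgr0Pnorm_le: eps0; apply.
have {}eps_le : eps n <= d / 2 by apply: le_trans (ler_norm _) eps_le.
pose t : R := n%:R `^ (- (6 * gamma) - d).
have powRn x m : (n%:R `^ x) ^+ m = n%:R `^ (x * m%:R) :> R.
  by rewrite powRrM powR_mulrn ?powR_ge0.
have sq_le : n%:R * (n%:R `^ (- alpha + eps n)) ^+ 2 <= t.
  rewrite -[X in X * _](powRr1 (ltW n_gt0)) powRn -powRD ?(gt_eqF n_gt0) ?implybT //.
  by apply: ler_powR => //; lra.
have lin_le : n%:R `^ (- alpha + eps n) <= t.
  by apply: ler_powR => //; lra.
rewrite [leRHS](_ : _ = n%:R `^ d * t); last first.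
  by rewrite powRn -powRD ?(gt_eqF n_gt0) ?implybT //; congr (_ `^ _); ring.
have t_ge0 : 0 <= t by exact: powR_ge0.
have : 3 * t <= n%:R `^ d * t by rewrite ler_wpM2r.
lra.
Unshelve. all: by end_near. Qed.

Lemma union_bound_cvg0 (gamma : R) (k0 : nat) : 2 < gamma * k0%:R ->
  (n%:R ^+ 2 * (expR 1 * (n%:R `^ (- gamma)) ^+ k0)) @[n --> \oo] --> (0 : R).
Proof.
move=> gap; have d_gt0 : 0 < gamma * k0%:R - 2 by rewrite subr_gt0.
rewrite -(mulr0 (expR 1 : R)).
apply: cvg_trans (cvgM (cvg_cst (expR 1 : R)) (powR_natN_cvg0 d_gt0)).
apply: near_eq_cvg; near=> n.
have n_gt0 : 0 < n%:R :> R by near: n; exact: nbhs_infty_gtr.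
rewrite [RHS]mulrCA; congr (_ * _).
rewrite -!powR_mulrn ?powR_ge0 ?(ltW n_gt0) // -powRrM.
rewrite -powRD ?(gt_eqF n_gt0) ?implybT //.
by congr (_ `^ _); ring.
Unshelve. all: by end_near. Qed.

End Asymptotics.

Local Open Scope classical_set_scope.

Theorem lemma1 (R : realType)
  (p : forall n : nat, 'I_n -> 'I_n -> R) (s : nat -> R)
  (alpha : R) (k : nat -> nat)
  (est : forall n : nat, outcome n -> matching n)
  (hp : forall n, edge_probabilities (p n))
  (hs : forall n, 0 <= s n <= 1)
  (halpha : 1 / 2 < alpha <= 1)
  (hpmax : exists eps : nat -> R,
     eps n @[n --> \oo] --> (0 : R) /\
     forall n, pmax (p n) <= n%:R `^ (- alpha + eps n))
  (hk0 : forall n, (0 < k n)%N)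
  (hk : forall n, 12 / (2 * alpha - 1) < (k n)%:R)
  (hest : forall n (w : outcome n),
     kcore_estimator (k n) (graph1 w) (graph2 w) (est n w)) :
  Pr (p n) (s n) (core_recovery (k n) (est n)) @[n --> \oo] --> (1 : R).
Proof.
have [eps [eps0 p_le]] := hpmax; have /andP[alpha_gt alpha_le] := halpha.
have a_gt0 : 0 < 2 * alpha - 1 by lra.
(* k may depend on n, so gamma is chosen from the least integer allowed. *)
pose k0 := (Num.truncn (12 / (2 * alpha - 1))).+1.
have k0_gt : 12 / (2 * alpha - 1) < k0%:R by exact: truncnS_gt.
have k0_le n : (k0 <= k n)%N.
  by rewrite truncn_lt_nat // ltW // divr_gt0.
have k0_gt0 : 0 < k0%:R :> R by rewrite ltr0n.
have gap : 2 / k0%:R < (2 * alpha - 1) / 6.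
  by move: k0_gt; rewrite !ltr_pdivrMr // mulrAC ltr_pdivlMr //; lra.
(* The midpoint of the interval of admissible exponents. *)
pose gamma := (2 / k0%:R + (2 * alpha - 1) / 6) / 2.
have gamma_k0 : 2 < gamma * k0%:R by rewrite -ltr_pdivrMr // /gamma; lra.
have gamma_6 : 6 * gamma < 2 * alpha - 1 by rewrite /gamma; lra.
have gamma_gt0 : 0 < gamma.
  by rewrite -(pmulr_lgt0 _ k0_gt0); exact: lt_trans gamma_k0.
pose u n : R := n%:R ^+ 2 * (expR 1 * (n%:R `^ (- gamma)) ^+ k0).
apply: (@squeeze_cvgr _ _ _ _ (fun n => 1 - (expR (u n) - 1)) (fun=> 1)).
- near=> n; have [p01 _ _] := hp n.
  rewrite Pr_le1 // andbT.
  have n_ge1 : 1 <= n%:R :> R by near: n; exact: nbhs_infty_ger.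
  have Y_gt0 : 0 < n%:R `^ (- gamma) by rewrite powR_gt0 // (lt_le_trans _ n_ge1).
  have Y_le1 : n%:R `^ (- gamma) <= 1.
    by rewrite -[leRHS](powRr0 n%:R) ler_powR // oppr_le0 ltW.
  have q_le : 2 * n%:R * (n%:R `^ (- alpha + eps n)) ^+ 2
      + n%:R `^ (- alpha + eps n) <= (n%:R `^ (- gamma)) ^+ 6.
    by near: n; exact: edge_weight_bound.
  apply: le_trans (Pr_core_recovery_ge p01 _ (hs n) (@hest n) _ _ q_le).
  + rewrite lerD2l lerN2 lerD2r ler_expR ler_wpM2l ?exprn_ge0 //.
    by rewrite ler_wpM2l ?expR_ge0 // ler_wiXn2l // ltW.
  + move=> i j; apply: le_trans (p_le n); rewrite /pmax.
    apply: le_trans (le_bigmax_cond 0 (fun l => \big[Order.max/0]_(j < n) p n l j)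
      (isT : xpredT i)).
    exact: (le_bigmax_cond 0 (p n i) (isT : xpredT j)).
  + exact: powR_ge0.
  + by rewrite Y_gt0.
- have lim1 : 1 - (expR 0 - 1) = 1 :> R by rewrite expR0 subrr subr0.
  rewrite -[X in _ --> X]lim1.
  apply: cvgB; first exact: cvg_cst.
  apply: cvgB; last exact: cvg_cst.
  exact: (cvg_comp _ _ (union_bound_cvg0 gamma_k0) (@continuous_expR R 0)).
- exact: cvg_cst.
Unshelve. all: by end_near. Qed.
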